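(* For every integer $k\ge 2$, let $A_k$ be the automaton over $X=\{0,1\}$ with kneading sequence $1(0^{k})^{\omega}$, i.e. the automaton with states $t,x_0,\dots,x_{k-1},id$ described in the context. Then the group $G(A_k)$ has subexponential growth.
   Context: Let $X=\{0,1\}$ and let $X^{*}$ be the free monoid on $X$, viewed as a rooted binary tree (the children of $w$ are $w0$ and $w1$). The automaton $A_k$ with kneading sequence $1(0^{k})^{\omega}$ has states $t,x_0,x_1,\dots,x_{k-1},id$, which act as automorphisms of $X^{*}$ fixing the empty word and given recursively by: $id$ is the identity; $t(0w)=1w$, $t(1w)=0w$; $x_0(0w)=0\,x_{k-1}(w)$, $x_0(1w)=1\,t(w)$; and for $1\le i\le k-1$, $x_i(0w)=0\,x_{i-1}(w)$, $x_i(1w)=1w$, for all $w\in X^{*}$. $G(A_k)$ is the subgroup of $\mathrm{Aut}(X^{*})$ generated by $t,x_0,\dots,x_{k-1}$. A finitely generated group has subexponential growth if $\lim_{n\to\infty}|B(n)|^{1/n}=1$, where $B(n)$ is the ball of radius $n$ in the word metric of some (equivalently any) finite generating set. *)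

(* Defs.v *)
From HB Require Import structures.
From mathcomp Require Import all_boot all_order all_algebra finmap.
From mathcomp Require Import all_classical all_reals all_analysis.

Set Implicit Arguments.
Unset Strict Implicit.
Unset Printing Implicit Defensive.

Import Order.TTheory GRing.Theory Num.Theory.
Import numFieldNormedType.Exports.

Local Open Scope classical_set_scope.

(* Letters 0 and 1 are encoded as false and true.  The first letter of a word
   is the one next to the root, so the children of w are rcons w 0 and
   rcons w 1. *)
Definition word := seq bool.

Definition child (u v : word) : Prop := exists x : bool, v = rcons u x.

Definition tree_automorphism (f : word -> word) : Prop :=
  [/\ bijective f, f [::] = [::] &
      forall u v, child u v <-> child (f u) (f v)].

Record tree_aut := TreeAut {
  aut_fun :> word -> word;
  _ : `[< tree_automorphism aut_fun >] }.

HB.instance Definition _ := [isSub for aut_fun].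
HB.instance Definition _ := [Choice of tree_aut by <:].

Definition mk_aut (f : word -> word) (hf : tree_automorphism f) : tree_aut :=
  TreeAut (asboolT hf).

Lemma tree_autP (f : tree_aut) : tree_automorphism f.
Proof. exact/asboolP/(valP f). Qed.

Lemma tree_aut_eqP (f g : tree_aut) : f =1 g -> f = g.
Proof. by move=> fg; apply/val_inj/funext. Qed.

Lemma id_tree_automorphism : tree_automorphism id.
Proof. by split=> //; exists id. Qed.

Lemma comp_tree_automorphism (f g : word -> word) :
  tree_automorphism f -> tree_automorphism g -> tree_automorphism (f \o g).
Proof.
move=> [bf f0 fc] [bg g0 gc]; split; first exact: (bij_comp bf bg).
  by rewrite /= g0.
by move=> u v; rewrite gc fc.
Qed.

Lemma tree_aut_surj (f : tree_aut) (w : word) : exists v, f v == w.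
Proof. by have [[g _ fg] _ _] := tree_autP f; exists (g w); rewrite fg. Qed.

Definition inv_word (f : tree_aut) (w : word) : word :=
  xchoose (tree_aut_surj f w).

Lemma inv_wordK (f : tree_aut) : cancel (inv_word f) f.
Proof. by move=> w; apply/eqP/(xchooseP (tree_aut_surj f w)). Qed.

Lemma inv_tree_automorphism (f : tree_aut) : tree_automorphism (inv_word f).
Proof.
have [bf f0 fc] := tree_autP f; have fK := inv_wordK f.
split.
- exists f => //; exact: (bij_can_sym bf _).1.
- by apply: (bij_inj bf); rewrite fK f0.
- by move=> u v; rewrite (fc (inv_word f u)) !fK.
Qed.

Definition aut_one : tree_aut := mk_aut id_tree_automorphism.

(* Product of automorphisms is composition: (f * g)(w) = f (g w). *)
Definition aut_mul (f g : tree_aut) : tree_aut :=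
  mk_aut (comp_tree_automorphism (tree_autP f) (tree_autP g)).

Definition aut_inv (f : tree_aut) : tree_aut :=
  mk_aut (inv_tree_automorphism f).

Lemma aut_mulA : associative aut_mul.
Proof. by move=> f g h; apply: tree_aut_eqP. Qed.

Lemma aut_mul1 : left_id aut_one aut_mul.
Proof. by move=> f; apply: tree_aut_eqP. Qed.

Lemma aut_mulr1 : right_id aut_one aut_mul.
Proof. by move=> f; apply: tree_aut_eqP. Qed.

Lemma aut_mulV : right_inverse aut_one aut_inv aut_mul.
Proof. by move=> f; apply: tree_aut_eqP => w /=; rewrite inv_wordK. Qed.

Lemma aut_mulVl : left_inverse aut_one aut_inv aut_mul.
Proof.
move=> f; apply: tree_aut_eqP => w /=.
by have [bf _ _] := tree_autP f; apply: (bij_inj bf); rewrite inv_wordK.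
Qed.

HB.instance Definition _ :=
  isGroup.Build tree_aut aut_mulA aut_mul1 aut_mulr1 aut_mulVl aut_mulV.

Section Growth.

Local Open Scope group_scope.

Variable gT : groupType.

Definition subgroup_gen (S : set gT) : set gT :=
  smallest (fun H : set gT => group_closed (mem H)) S.

Definition ball_word (S : set gT) (n : nat) : set gT :=
  [set g | exists s : seq gT,
     [/\ size s <= n,
         (forall x, x \in s -> S x \/ S x^-1) &
         g = \prod_(x <- s) x] ].

Lemma ball_word_finite (S : set gT) (n : nat) :
  finite_set S -> finite_set (ball_word S n).
Proof.
move=> fS; elim: n => [|n IH].
  apply: (sub_finite_set (B := [set 1])); last exact: finite_set1.
  by move=> g [s [+ _ ->]]; rewrite leqn0 size_eq0 => /eqP ->; rewrite big_nil.
pose T : set gT := S `|` (fun x : gT => x^-1) @` S.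
have fT : finite_set T by rewrite finite_setU; split=> //; exact: finite_image.
apply: (sub_finite_set (B := [set 1] `|`
  (fun p : gT * gT => p.1 * p.2) @` (T `*` ball_word S n))); last first.
  rewrite finite_setU; split; first exact: finite_set1.
  exact/finite_image/finite_setX.
move=> g [[|x s] [sz sS ->]]; first by left; rewrite big_nil.
right; exists (x, \prod_(y <- s) y); last by rewrite big_cons.
split=> /=.
  have [Sx|Sx] := sS x (mem_head x s); first by left.
  by right; exists x^-1 => //; rewrite invgK.
by exists s; split=> // y ys; apply: sS; rewrite inE ys orbT.
Qed.

(* fset_set is the set itself (as a finite set), not its default value,
   thanks to ball_word_finite. *)
Definition ball_card (S : set gT) (n : nat) : nat :=
  #|` fset_set (ball_word S n)|.

Definition subexponential_growth (R : realType) (G : set gT) : Prop :=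
  exists S : set gT,
    [/\ finite_set S, subgroup_gen S = G &
        (fun n : nat => ((ball_card S n)%:R `^ n%:R^-1)%R : R) @ \oo -->
          (1%R : R) ].

End Growth.

Record automaton := Automaton {
  state : Type;
  output : state -> bool -> bool;
  transition : state -> bool -> state;
  output_inj : forall q, injective (output q) }.

Fixpoint act_word (A : automaton) (q : state A) (w : word) : word :=
  if w is x :: w' then output q x :: act_word (transition q x) w' else [::].

Lemma act_size (A : automaton) (q : state A) (w : word) :
  size (act_word q w) = size w.
Proof. by elim: w q => //= x w IH q; rewrite IH. Qed.

Lemma act_inj (A : automaton) (q : state A) : injective (act_word q).
Proof.
move=> u; elim: u q => [|x u IH] q [|y v] //= [/output_inj ->].
by move=> /IH ->.
Qed.

Lemma act_surj (A : automaton) (q : state A) (w : word) :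
  exists v, act_word q v == w.
Proof.
elim: w q => [|y w IH] q; first by exists [::].
have [h _ oh] := injF_bij (@output_inj A q).
have [v /eqP vw] := IH (transition q (h y)).
by exists (h y :: v); rewrite /= oh vw.
Qed.

Lemma act_rcons (A : automaton) (q : state A) (u : word) (x : bool) :
  exists y, act_word q (rcons u x) = rcons (act_word q u) y.
Proof.
elim: u q => [|z u IH] q /=; first by exists (output q x).
by have [y ->] := IH (transition q z); exists y.
Qed.

Lemma act_tree_automorphism (A : automaton) (q : state A) :
  tree_automorphism (act_word q).
Proof.
split=> //.
- exists (fun w => xchoose (act_surj q w)) => w; last first.
    exact/eqP/(xchooseP (act_surj q w)).
  by apply: (@act_inj _ q); apply/eqP/(xchooseP (act_surj q _)).
- move=> u v; split=> [[x ->]|[x]]; first exact: act_rcons.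
  case/lastP: v => [|v y]; first by move/(congr1 size); rewrite size_rcons.
  have [z ->] := act_rcons q v y => /rcons_inj[/act_inj -> _].
  by exists y.
Qed.

Definition state_aut (A : automaton) (q : state A) : tree_aut :=
  mk_aut (act_tree_automorphism q).

Inductive kneading_state (k : nat) :=
  | st_t | st_x of 'I_k | st_id.

Arguments st_t {k}.
Arguments st_id {k}.

Definition kneading_output (k : nat) (q : kneading_state k) (x : bool) : bool :=
  if q is st_t then ~~ x else x.

(* ord_pred is the cyclic predecessor: it sends i > 0 to i - 1, and 0 to
   k - 1. *)
Definition kneading_transition (k : nat) (q : kneading_state k) (x : bool) :
    kneading_state k :=
  match q, x with
  | st_x i, false => st_x (ord_pred i)
  | st_x i, true => if i == 0 :> nat then st_t else st_id
  | _, _ => st_id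
  end.

Lemma kneading_output_inj (k : nat) (q : kneading_state k) :
  injective (kneading_output q).
Proof. by case: q => [|i|] []  []. Qed.

(* The automaton with kneading sequence 1(0^k)^omega. *)
Definition kneading_automaton (k : nat) : automaton :=
  Automaton (@kneading_transition k) (@kneading_output_inj k).

Definition aut_t (k : nat) : tree_aut :=
  state_aut (A := kneading_automaton k) st_t.

Definition aut_x (k : nat) (i : 'I_k) : tree_aut :=
  state_aut (A := kneading_automaton k) (st_x i).

Definition kneading_group (k : nat) : set tree_aut :=
  subgroup_gen ([set aut_t k] `|` range (@aut_x k)).

Section Recursion.

Variable k : nat.

Lemma act_id (w : word) : act_word (A := kneading_automaton k) st_id w = w.
Proof. by elim: w => //= x w IH; rewrite IH; case: x. Qed.

Lemma aut_tE (w : word) :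
  (aut_t k) (false :: w) = true :: w /\
  (aut_t k) (true :: w) = false :: w.
Proof. by rewrite /= act_id. Qed.

Lemma aut_x0E (i j : 'I_k) (w : word) :
  i = 0 :> nat -> j = k.-1 :> nat ->
  (aut_x i) (false :: w) = false :: (aut_x j) w /\
  (aut_x i) (true :: w) = true :: (aut_t k) w.
Proof.
move=> i0 jk; rewrite /= i0 eqxx; split=> //.
suff -> : ord_pred i = j by [].
apply/val_inj; rewrite /= i0 jk add0n modn_small // ltn_predL.
exact: leq_ltn_trans (ltn_ord i).
Qed.

Lemma aut_xSE (i j : 'I_k) (w : word) :
  i = j.+1 :> nat ->
  (aut_x i) (false :: w) = false :: (aut_x j) w /\
  (aut_x i) (true :: w) = true :: w.
Proof.
move=> ij; rewrite /= ij /= act_id; split=> //.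
suff -> : ord_pred i = j by [].
by apply/val_inj; rewrite /= ij addSn modnDr modn_small.
Qed.

End Recursion.

(* Main.v *)
Require Import Defs.
From mathcomp Require Import all_boot all_order all_algebra.
From mathcomp Require Import finmap zify ring lra.
From mathcomp Require Import all_classical all_reals all_analysis.

(* The x_i are commuting involutions; let E be the finite group they generate,
   whose elements e have sections (rotate e, t^(e 0)).  Every element of G(A_k)
   is t^a (e_1 t) ... (e_n t) f with e_i, f in E, and its two sections share the
   letters rotate e_i and t^(e_i 0).  For a suitable weight on E, the letter e_i
   followed by t loses, in passing to the sections, the number of zero
   coordinates of e_i.  Hence either a fixed proportion of the letters differ
   from the all-ones element and the total weight of the sections contracts by
   a constant factor, or the element lies in a family of arbitrarily small
   exponential growth rate.  A growth rate a > a0 thus improves to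
   max(a0, th * a) with th < 1 depending on a0 only; iterating brings the rate
   down to a0. *)

Set Implicit Arguments.
Unset Strict Implicit.
Unset Printing Implicit Defensive.

Import Order.TTheory GRing.Theory Num.Theory.
Import numFieldNormedType.Exports.

Local Open Scope classical_set_scope.

(** * First-level decomposition of tree maps *)

Definition flip (b : bool) (w : word) : word :=
  if w is x :: w' then (x (+) b) :: w' else [::].

(** Wreath recursion: [p] is the action on the first letter, [g0] and [g1] are the sections at 0 and
    1. *)
Definition recon (p : bool) (g0 g1 : word -> word) (w : word) : word :=
  if w is x :: w' then (x (+) p) :: (if x then g1 else g0) w' else [::].

Lemma flip0 : flip false = id.
Proof. by apply/funext=> -[|[] w]. Qed.

Lemma flip_comp (a b : bool) : flip a \o flip b = flip (a (+) b).
Proof. by apply/funext=> -[|x w] //=; rewrite -addbA (addbC b). Qed.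

Lemma flip_recon (a p : bool) (g0 g1 : word -> word) :
  flip a \o recon p g0 g1 = recon (p (+) a) g0 g1.
Proof. by apply/funext=> -[|x w] //=; rewrite addbA. Qed.

(** * The finite group generated by the [x_i] *)

Section Directed.

Variable k' : nat.
Local Notation k := k'.+1.

(* [e] stands for the product of the commuting involutions [x_i] over the
   [i] with [e i]; its sections are [rotate e] at 0 and t^(e 0) at 1. *)
Definition dir := {ffun 'I_k -> bool}.

Implicit Types (e f : dir) (s : seq dir) (g : word -> word).

Definition rotate e : dir := [ffun i => e (ordS i)].
Definition xor e f : dir := [ffun i => e i (+) f i].

Fixpoint act e (w : word) : word :=
  match w with
  | [::] => [::]
  | false :: w' => false :: act (rotate e) w'
  | true :: w' => true :: flip (e ord0) w'
  end.

Lemma act_xor e f : act e \o act f = act (xor e f).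
Proof.
apply/funext => w /=; elim: w e f => [//|[] w IH] e f /=.
  by rewrite -[flip _ (flip _ _)]/((flip _ \o flip _) w) flip_comp ffunE.
by rewrite IH; congr (_ :: act _ _); apply/ffunP => i; rewrite !ffunE.
Qed.

Lemma act0 : act [ffun => false] = id.
Proof.
apply/funext; elim=> [//|[] w IH] /=; first by rewrite ffunE flip0.
by rewrite -[in RHS]IH; congr (_ :: act _ _); apply/ffunP=> i; rewrite !ffunE.
Qed.

Lemma act_recon e : act e = recon false (act (rotate e)) (flip (e ord0)).
Proof. by apply/funext => -[|[] w]. Qed.

(** * Weights and their loss under passage to sections *)

Definition zeros e : nat := \sum_(i < k) ~~ e i.
(** The constant [k * k] is at least the sum of all the coefficients, which makes the weight
    subadditive ([weight_xor]). *)
Definition weight e : nat := k * k + \sum_(i < k) i * ~~ e i.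
Definition weight_max : nat := k * k + \sum_(i < k) i.

(* The coefficients [i] in [weight] solve this cohomological equation: passing
   to the sections of a letter followed by t (of weight k) loses exactly
   [zeros e]. *)
Lemma weight_rotate e : weight (rotate e) + k * e ord0 + zeros e = weight e + k.
Proof.
rewrite /weight /zeros.
have -> : \sum_(i < k) i * ~~ e i = \sum_(i < k') i.+1 * ~~ e (lift ord0 i).
  by rewrite big_ord_recl mul0n.
(* Coordinate 0 moves to the last place, with coefficient [k']. Together with its unit in [zeros]
   and with [k * e ord0] it contributes [k], whatever [e ord0] is. *)
have -> : \sum_(i < k) i * ~~ rotate e i
   = \sum_(i < k') i * ~~ e (lift ord0 i) + k' * ~~ e ord0.
  rewrite big_ord_recr /= ffunE; congr (_ + _ * ~~ e _).
    apply: eq_bigr => i _; rewrite ffunE; congr (_ * ~~ e _); apply/val_inj.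
    by rewrite /= modn_small // ltnS.
  by apply/val_inj; rewrite /= modnn.
have -> : \sum_(i < k') i.+1 * ~~ e (lift ord0 i)
   = \sum_(i < k') i * ~~ e (lift ord0 i) + \sum_(i < k') ~~ e (lift ord0 i).
  by rewrite -big_split; apply: eq_bigr => i _; rewrite /= mulSn addnC.
rewrite big_ord_recl; case: (e ord0) => /=; lia.
Qed.

Lemma weight_le_max e : weight e <= weight_max.
Proof.
rewrite leq_add2l; apply: leq_sum => i _.
by case: (e i); rewrite ?muln0 ?muln1.
Qed.

Lemma weight_xor e f : weight (xor e f) <= weight e + weight f.
Proof.
apply: leq_trans (weight_le_max _) _; rewrite /weight_max /weight.
suff : \sum_(i < k) i <= k * k by lia.
rewrite -[X in X * _]card_ord -sum_nat_const; apply: leq_sum => i _.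
exact: ltnW.
Qed.

Definition ones : dir := [ffun => true].

Lemma zeros_gt0 e : (e != ones) <= zeros e.
Proof.
have [//|/= ne] := eqVneq e ones; rewrite lt0n; apply: contraNneq ne => z0.
apply/eqP/ffunP => i; rewrite ffunE; apply/negbNE; rewrite -eqb0 -leqn0 -z0.
by rewrite /zeros (bigD1 i) //= leq_addr.
Qed.

(** * Normal forms and their sections *)

Definition nf s f : word -> word :=
  foldr (fun e g => act e \o flip true \o g) (act f) s.

Definition cost s : nat := \sum_(e <- s) (weight e + k).

(** The last letter [f] is free of charge, since it ranges over a finite group; the leading [flip a]
    is charged [k], like every other t. *)
Definition short (r : nat) : set (word -> word) :=
  [set g | exists a s f, g = flip a \o nf s f /\ k * a + cost s <= r].

Lemma short_mono r r' g : r <= r' -> short r g -> short r' g.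
Proof.
by move=> rr' [a [s [f [-> le]]]]; exists a, s, f; split=> //; lia.
Qed.

Lemma short_act0 e : short 0 (act e).
Proof. by exists false, [::], e; rewrite /cost big_nil flip0 muln0. Qed.

Lemma short_id : short 0 id.
Proof. by rewrite -act0; exact: short_act0. Qed.

Lemma short_flip r (b : bool) g : short r g -> short (r + k * b) (flip b \o g).
Proof.
move=> [a [s [f [-> le]]]]; exists (b (+) a), s, f; split.
  by rewrite -flip_comp.
by case: a b le => -[]/=; lia.
Qed.

(** In front of a leading t, [e] opens a new pair, and the [k] already paid for that t becomes part
    of its cost. Otherwise [e] merges with the first letter, at a cost bounded by [weight_xor], or
    with the free [f]. *)
Lemma short_act r e g : short r g -> short (r + weight e) (act e \o g).
Proof.
move=> [[] [s [f [-> le]]]].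
  exists false, (e :: s), f; split; first by rewrite flip0.
  by rewrite /cost big_cons -/(cost s); lia.
case: s le => [|e1 s] le.
  exists false, [::], (xor e f); split; last by rewrite /cost big_nil; lia.
  by rewrite /= -act_xor flip0.
exists false, (xor e e1 :: s), f; split.
  by rewrite /= -act_xor !flip0.
move: le; rewrite /cost !big_cons; have := weight_xor e e1; lia.
Qed.

Definition defects s : nat := count (predC1 ones) s.

(** Each pair [e] t gives [rotate e] to one section and [flip (e ord0)] to the other. Which section
    gets which depends on [p], but the sum of the costs does not, and each defect saves at least 1
    by [weight_rotate]. The extra [k] pays for [flip (f ord0)], as [f] itself is free. *)
Lemma nf_sections s f : exists p g0 g1 r0 r1,
  [/\ nf s f = recon p g0 g1, short r0 g0, short r1 g1 &
      r0 + r1 + defects s <= cost s + k].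
Proof.
elim: s => [|e s [p [g0 [g1 [r0 [r1 [E s0 s1 le]]]]]]].
  exists false, (act (rotate f)), (flip (f ord0) \o id), 0, (0 + k * f ord0).
  split=> //; first by rewrite /= act_recon.
  - exact: short_act0.
  - exact/short_flip/short_id.
  - by rewrite /cost big_nil /=; case: (f ord0); lia.
have le1 : r0 + r1 + (weight (rotate e) + k * e ord0) + defects (e :: s)
    <= cost (e :: s) + k.
  rewrite /cost big_cons -/(cost s) /=.
  have := weight_rotate e; have := zeros_gt0 e.
  by rewrite /defects /= in le *; lia.
have Ee : nf (e :: s) f = recon (~~ p)
    ((if p then act (rotate e) else flip (e ord0)) \o g0)
    ((if p then flip (e ord0) else act (rotate e)) \o g1).
  rewrite -[LHS]/(act e \o flip true \o nf s f) E.
  by apply/funext => -[|[] w] //=; case: p {E}.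
move: Ee; case: p {E} => Ee.
  exists false, (act (rotate e) \o g0), (flip (e ord0) \o g1),
    (r0 + weight (rotate e)), (r1 + k * e ord0); split=> //.
  - exact: short_act.
  - exact: short_flip.
  - lia.
exists true, (flip (e ord0) \o g0), (act (rotate e) \o g1),
  (r0 + k * e ord0), (r1 + weight (rotate e)); split=> //.
- exact: short_flip.
- exact: short_act.
- lia.
Qed.

Lemma size_le_cost s : size s <= cost s.
Proof.
elim: s => [//|e s IH]; rewrite /cost big_cons -/(cost s) /=; lia.
Qed.

(** * The generators as [act] and [flip] *)

Lemma aut_x_act (i : 'I_k) (w : word) :
  aut_x i w = act [ffun j => j == i] w.
Proof.
rewrite /aut_x /=; elim: w i => [//|[] w IH] i /=.
  congr (_ :: _); rewrite ffunE -(inj_eq val_inj) /= eq_sym.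
  case: eqP => _; last by rewrite act_id flip0.
  by case: w {IH} => //= x w; rewrite act_id addbT.
rewrite IH; congr (_ :: act _ _); apply/ffunP => j; rewrite !ffunE.
by rewrite -[in LHS](can_eq (@ordSK _)) ord_predK.
Qed.

Lemma aut_t_flip (w : word) : aut_t k w = flip true w.
Proof. by case: w => //= x w; rewrite act_id addbT. Qed.


(** * Enumeration, with repetitions, of the words with few defects *)

Fixpoint few n m : seq (seq dir) :=
  if n is n'.+1 then
    [::] :: [seq ones :: s | s <- few n' m] ++
      (if m is m'.+1 then
         [seq e :: s | e <- enum dir, s <- few n' m'] else [::])
  else [:: [::]].

Lemma mem_few n m s : size s <= n -> defects s <= m -> s \in few n m.
Proof.
elim: n m s => [|n IH] m [|e s] //=; rewrite ltnS => sz.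
rewrite in_cons mem_cat /defects /=; have [->|ne] := eqVneq e ones => /= le.
  by apply/orP; left; apply: map_f; apply: IH.
case: m le => [//|m le]; apply/orP; right.
by apply: allpairs_f; [rewrite mem_enum | apply: IH].
Qed.

End Directed.

(** * Counting by covering lists *)

Section Covers.

Variables (R : realType).
Local Open Scope ring_scope.

(** Lists may repeat elements, so unions, products and images are bounded without any cardinality of
    sets. *)
Definition covered (T : eqType) (A : set T) (c : R) : Prop :=
  exists2 l : seq T, (size l)%:R <= c & forall x, A x -> x \in l.

Lemma covered_sub (T : eqType) (A B : set T) (c d : R) :
  (forall x, A x -> B x) -> c <= d -> covered B c -> covered A d.
Proof.
move=> AB cd [l sl lB]; exists l; first exact: le_trans cd.
by move=> x /AB /lB.
Qed.

Lemma covered_bigcup (T : eqType) (n : nat) (A : nat -> set T) (c : R) :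
  (forall i, (i < n)%N -> covered (A i) c) ->
  covered [set x | exists2 i, (i < n)%N & A i x] (n%:R * c).
Proof.
elim: n => [|n IH] hA; first by exists [::]; [rewrite mul0r | move=> x []].
have [|l sl lP] := IH; first by move=> i /ltnW; exact: hA.
have [l' sl' lP'] := hA n (ltnSn n).
exists (l ++ l'); first by rewrite size_cat natrD -natr1 mulrDl mul1r lerD.
move=> x [i + Ax]; rewrite ltnS leq_eqVlt mem_cat => /orP[/eqP E|lt].
  by rewrite lP' ?orbT// -E.
by rewrite lP//; exists i.
Qed.

Lemma covered_fin (T : finType) (A : set T) : covered A #|T|%:R.
Proof. by exists (enum T) => [|x _]; rewrite -?cardE ?mem_enum. Qed.

Lemma covered_or (T : eqType) (A B : set T) (c d : R) :
  covered A c -> covered B d -> covered [set x | A x \/ B x] (c + d).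
Proof.
move=> [l sl lA] [m sm mB]; exists (l ++ m).
  by rewrite size_cat natrD lerD.
by move=> x [/lA|/mB] xl; rewrite mem_cat xl ?orbT.
Qed.

Lemma covered_prod (T U : eqType) (A : set T) (B : set U) (c d : R) :
  covered A c -> covered B d ->
  covered [set z : T * U | A z.1 /\ B z.2] (c * d).
Proof.
move=> [l sl lA] [m sm mB]; exists [seq (x, y) | x <- l, y <- m].
  by rewrite size_allpairs natrM ler_pM.
by move=> [x y] [/lA xl /mB ym]; exact: allpairs_f.
Qed.

Lemma covered_image (T U : eqType) (h : T -> U) (A : set T) (c : R) :
  covered A c -> covered [set y | exists2 x, A x & y = h x] c.
Proof.
move=> [l sl lA]; exists [seq h x | x <- l]; first by rewrite size_map.
by move=> y [x /lA xl ->]; exact: map_f.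
Qed.

(** Lets a linear factor be absorbed into an arbitrarily small exponential rate. *)
Lemma linear_le_expR (c : R) : 0 < c ->
  exists2 K, 0 <= K & forall n : nat, n.+1%:R <= K * expR (c * n%:R).
Proof.
move=> c0; have ic0 : 0 < c^-1 by rewrite invr_gt0.
exists (1 + c^-1) => [|n]; first by rewrite addr_ge0// ltW.
apply: le_trans (ler_wpM2l _ (expR_ge1Dx _)); last by rewrite addr_ge0// ltW.
rewrite mulrDl mulrDr mul1r mulrDr mulr1 mulKf ?gt_eqF// -natr1.
have : 0 <= c * n%:R by rewrite mulr_ge0// ltW.
by move: ic0; move: (c^-1) (c * _) => u v; lra.
Qed.

End Covers.

(** * Exponential growth rates *)

Section Rates.

Variables (R : realType) (k' : nat).
Local Open Scope ring_scope.
Local Notation k := k'.+1.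
Local Notation q := (#|{: dir k'}|%:R : R).

(** Chernoff-type bound: with a factor exp(-c) per defect, each letter contributes at most 1 + q
    exp(-c) <= exp(q exp(-c)). The factor [n.+1] accounts for the possible lengths. *)
Lemma size_few (c : R) (n m : nat) : 0 <= c ->
  (size (few k' n m))%:R <=
    n.+1%:R * expR (m%:R * c + n%:R * (q * expR (- c))).
Proof.
move=> c0; set d := q * expR (- c).
have d0 : 0 <= d by rewrite mulr_ge0// expR_ge0.
elim: n m => [|n IH] m.
  rewrite /= mul1r mul0r addr0 (le_trans _ (expR_ge1Dx _))//.
  by rewrite lerDl mulr_ge0.
have H : 1 <= expR (m%:R * c + n.+1%:R * d).
  rewrite (le_trans _ (expR_ge1Dx _))//.
  by rewrite lerDl addr_ge0// mulr_ge0.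
rewrite -[n.+2%:R]natr1 mulrDl mul1r /= -[X in X <= _]natr1.
rewrite size_cat size_map natrD.
apply: lerD => //.
have -> : expR (m%:R * c + n.+1%:R * d) = expR (m%:R * c + n%:R * d) * expR d.
  by rewrite -expRD -natr1 mulrDl mul1r addrA.
have step : expR (m%:R * c + n%:R * d) * (1 + d) <=
    expR (m%:R * c + n%:R * d) * expR d.
  by rewrite ler_wpM2l ?expR_ge0// expR_ge1Dx.
apply: le_trans (ler_wpM2l (ler0n _ _) step).
rewrite !mulrDr mulr1; apply: lerD; first exact: IH.
case: m {H step} => [|m]; first by rewrite !mulr_ge0 ?expR_ge0.
rewrite size_allpairs -cardE natrM.
apply: le_trans (ler_wpM2l (ler0n _ _) (IH m)) _.
have -> : m.+1%:R * c + n%:R * d = (m%:R * c + n%:R * d) + c.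
  by rewrite -[m.+1%:R]natr1 mulrDl mul1r addrAC.
rewrite (expRD _ c) /d expRN; set E := expR _.
have c1 : expR c != 0 by rewrite gt_eqF// expR_gt0.
by rewrite le_eqVlt; apply/orP; left; apply/eqP; field.
Qed.

Definition rate_le (a : R) : Prop :=
  exists C, forall r, covered (short k' r) (C * expR (a * r%:R)).

Lemma rate_le_mono (a b : R) : a <= b -> rate_le a -> rate_le b.
Proof.
move=> ab [C hC]; exists C => r; apply: covered_sub (hC r) => //.
(* At radius 0 the constant bounds the length of a list. *)
have C0 : 0 <= C.
  have [l + _] := hC 0%N; rewrite mulr0 expR0 mulr1; exact: le_trans.
by rewrite ler_wpM2l// ler_expR ler_wpM2r.
Qed.

Lemma covered_few (c : R) (n m : nat) : 0 <= c ->
  covered [set g | exists a (s : seq (dir k')) f,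
      [/\ (size s <= n)%N, (defects s <= m)%N &
      g = flip a \o nf s f]]
    (2 * q * (n.+1%:R * expR (m%:R * c + n%:R * (q * expR (- c))))).
Proof.
move=> c0.
have cf : covered [set s : seq (dir k') | (size s <= n)%N /\ (defects s <= m)%N]
    (n.+1%:R * expR (m%:R * c + n%:R * (q * expR (- c)))).
  exists (few k' n m); first exact: size_few.
  by move=> s [sn sm]; exact: mem_few.
have := covered_image
  (fun z : (bool * dir k') * seq (dir k') => flip z.1.1 \o nf z.2 z.1.2)
  (covered_prod (covered_fin R [set: bool * dir k']) cf).
apply: covered_sub; last by rewrite card_prod card_bool natrM.
by move=> g [a [s [f [sn sm ->]]]]; exists ((a, f), s).
Qed.

Lemma rate_le_init : exists a, rate_le a.
Proof.
have [K K0 hK] := @linear_le_expR R 1 ltr01.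
(* With [c] = 0 and both bounds equal to [r], the family of few defects contains everything; its
   rate is [q], and the 1 absorbs the factor [r.+1]. *)
exists (1 + q), (2 * q * K) => r.
apply: covered_sub (@covered_few 0 r r (lexx 0)).
  move=> g [a [s [f [-> le]]]]; exists a, s, f; split=> //.
    by have := size_le_cost s; lia.
  apply: leq_trans (count_size _ _) (leq_trans (size_le_cost s) _).
  by apply: leq_trans le; exact: leq_addl.
rewrite mulr0 add0r oppr0 expR0 mulr1 -[leRHS]mulrA ler_wpM2l ?mulr_ge0//.
rewrite (mulrDl 1 q) expRD (mulrC q) mulrA ler_wpM2r ?expR_ge0//.
Qed.

(** By monotonicity only the [s.+1] pairs of radii (i, s - i) matter, and each of them has the same
    bound because the exponents add up to [a * s]. *)
Lemma covered_sections (C a : R) (s : nat) :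
  (forall r, covered (short k' r) (C * expR (a * r%:R))) ->
  covered [set g | exists p g0 g1 r0 r1, [/\ short k' r0 g0, short k' r1 g1,
      (r0 + r1 <= s)%N & g = recon p g0 g1]]
    (s.+1%:R * (2 * (C ^+ 2 * expR (a * s%:R)))).
Proof.
move=> hC; pose rec (z : bool * ((word -> word) * (word -> word))) :=
  recon z.1 z.2.1 z.2.2.
have ci i : (i < s.+1)%N -> covered [set g | exists2 z, [set: bool] z.1 /\
    (short k' i z.2.1 /\ short k' (s - i) z.2.2) & g = rec z]
    (2 * (C ^+ 2 * expR (a * s%:R))).
  rewrite ltnS => le.
  apply: covered_sub (covered_image rec (covered_prod
    (covered_fin R [set: bool]) (covered_prod (hC i) (hC (s - i)%N)))) => //.
  rewrite card_bool mulrACA -expr2 -expRD -mulrDr -natrD subnKC//.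
apply: covered_sub (covered_bigcup ci) => // g.
move=> [p [g0 [g1 [r0 [r1 [s0 s1 le ->]]]]]].
exists r0; first lia.
exists (p, (g0, g1)) => //=; split=> //; split=> //.
by apply: short_mono s1; lia.
Qed.

(* Either few letters differ from [ones], and there are few such words, or the
   sections are shorter by the factor 1 - 1/p. *)
Lemma rate_contraction (a0 : R) : 0 < a0 -> exists2 th, 0 <= th < 1 &
  forall a, a0 <= a -> rate_le a -> rate_le (Num.max a0 (th * a)).
Proof.
move=> a0_gt0.
have q0 : 0 < q by rewrite ltr0n; apply/card_gt0P; exists (ones k').
(* Chosen so that exp(c) >= c yields q exp(-c) <= a0 / 4. *)
pose c := 4 * q / a0.
have c_gt0 : 0 < c by rewrite divr_gt0// mulr_gt0.
have cq : q * expR (- c) <= a0 / 4.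
  rewrite expRN ler_pdivrMr ?expR_gt0//.
  have -> : q = a0 / 4 * c by rewrite /c; field; rewrite gt_eqF.
  rewrite ler_wpM2l ?divr_ge0 ?(ltW a0_gt0)//.
  by apply: le_trans (expR_ge1Dx _); rewrite lerDr.
(* With at most r / p defects, the term m c is also at most r a0 / 4, so the first family has rate
   a0 / 2 before its linear factor. *)
have [p p_gt0 cp] : exists2 p : nat, (0 < p)%N & c / p%:R <= a0 / 4.
  exists (Num.Def.archi_bound (4 * c / a0)).+1 => //.
  rewrite ler_pdivrMr ?ltr0n// -ler_pdivrMl ?divr_gt0//.
  have -> : (a0 / 4)^-1 * c = 4 * c / a0 by field; rewrite gt_eqF.
  apply: ltW; apply: lt_trans (archi_boundP _) _; last by rewrite ltr_nat.
  by rewrite ltW// divr_gt0// mulr_gt0.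
have p0 : 0 < p%:R :> R by rewrite ltr0n.
have [u uE] : exists u : R, u = p%:R^-1 by exists p%:R^-1.
rewrite -uE in cp.
have ip : 0 < u <= 1 by rewrite uE invr_gt0 p0 invf_le1// ler1n.
(* The sections save a proportion [u] of the length; half of this saving absorbs the linear factor
   [s.+1], at rate a0 u / 2 <= a u / 2. *)
exists (1 - u / 2); first by move: ip; clear; lra.
move=> a a0a [C hC]; have d0 : 0 < a0 * u / 2.
  by rewrite divr_gt0// mulr_gt0//; case/andP: ip.
have [K K0 hK] := linear_le_expR d0.
(* One summand for each case. In [k%:R + 1], the [k] is the additive loss in [nf_sections] and the 1
   is the rounding of r / p. *)
exists (2 * q * K + k.+1%:R * K * (2 * (C ^+ 2 * expR (a * (k%:R + 1))))) => r.
set M := Num.max _ _.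
have aM : a0 <= M /\ (1 - u / 2) * a <= M by rewrite !le_max !lexx orbT.
pose m := (r %/ p)%N; pose s := (r - m + k)%N.
have mr : (m <= r)%N by exact: leq_div.
have m1 : m%:R <= r%:R * u.
  by rewrite uE ler_pdivlMr// -natrM ler_nat leq_trunc_div.
have m2 : r%:R * u <= m%:R + 1.
  by rewrite uE ler_pdivrMr// natr1 -natrM ler_nat ltnW// ltn_ceil.
apply: covered_sub
  (covered_or (@covered_few c r m (ltW c_gt0)) (covered_sections s hC)).
  move=> g [b [w [f [-> le]]]]; have [few|many] := leqP (defects w) m.
    left; exists b, w, f; split=> //.
    exact: leq_trans (size_le_cost w) (leq_trans (leq_addl _ _) le).
  right; have [x [g0 [g1 [r0 [r1 [-> s0 s1 le']]]]]] := nf_sections w f.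
  exists (x (+) b), g0, g1, r0, r1; split=> //; last exact: flip_recon.
  rewrite /s; clearbody m; clear -le' le many mr; lia.
rewrite [leRHS]mulrDl; apply: lerD.
  rewrite -[leRHS]mulrA ler_wpM2l ?mulr_ge0//.
  apply: le_trans (ler_wpM2r (expR_ge0 _) (hK r)) _.
  rewrite -[leLHS]mulrA ler_wpM2l// -expRD ler_expR.
  have h1 : m%:R * c <= r%:R * (a0 / 4).
    apply: le_trans (ler_wpM2r (ltW c_gt0) m1) _.
    by rewrite -mulrA ler_wpM2l// mulrC.
  have h2 : r%:R * (q * expR (- c)) <= r%:R * (a0 / 4) by rewrite ler_wpM2l.
  have h3 : a0 * u / 2 * r%:R <= r%:R * (a0 / 2).
    rewrite mulrC ler_wpM2l// ler_wpM2r// ler_piMr ?(ltW a0_gt0)//.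
    by case/andP: ip.
  have h4 : r%:R * a0 <= M * r%:R by rewrite mulrC ler_wpM2r//; case: aM.
  by move: h1 h2 h3 h4; lra.
have hs : s.+1%:R <= k.+1%:R * K * expR (a0 * u / 2 * r%:R).
  apply: (@le_trans _ _ (k.+1%:R * r.+1%:R)).
    have sr : (s <= r + k)%N by rewrite leq_add2r leq_subr.
    rewrite -natrM ler_nat mulSn mulnS addSn ltnS addnA.
    exact: leq_trans sr (leq_addr _ _).
  by rewrite -mulrA ler_wpM2l.
apply: le_trans (ler_wpM2r _ hs) _.
  by rewrite mulr_ge0// mulr_ge0 ?sqr_ge0 ?expR_ge0.
suff le_exp : expR (a0 * u / 2 * r%:R) * expR (a * s%:R) <=
    expR (a * (k%:R + 1)) * expR (M * r%:R).
  have c0 : 0 <= k.+1%:R * K * (2 * C ^+ 2).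
    by apply: mulr_ge0; [exact: mulr_ge0 | rewrite mulr_ge0// sqr_ge0].
  have := ler_wpM2l c0 le_exp; move: (expR _) (expR _) (expR _) (expR _).
  move=> E1 E2 E3 E4; congr (_ <= _); ring.
rewrite -!expRD ler_expR.
have -> : s%:R = r%:R - m%:R + k%:R :> R by rewrite /s natrD natrB.
have a_ge0 : 0 <= a by apply: le_trans a0a; exact: ltW.
have h1 : a * (r%:R - m%:R + k%:R) <= a * (r%:R - r%:R * u + (k%:R + 1)).
  by rewrite ler_wpM2l//; move: m2; lra.
have h2 : a0 * u / 2 * r%:R <= a * u / 2 * r%:R.
  by rewrite !ler_wpM2r ?invr_ge0//; case/andP: ip => /ltW.
have h3 : (1 - u / 2) * a * r%:R <= M * r%:R by rewrite ler_wpM2r//; case: aM.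
by move: h1 h2 h3; lra.
Qed.

Lemma rate_le_pos (a0 : R) : 0 < a0 -> rate_le a0.
Proof.
move=> a0_gt0; have [th /andP[th0 th1] hth] := rate_contraction a0_gt0.
have [b hb] := rate_le_init; pose b' := Num.max b 0.
have b'0 : 0 <= b' by rewrite le_max lexx orbT.
have it n : rate_le (Num.max a0 (th ^+ n * b')).
  elim: n => [|n IH].
    by apply: rate_le_mono hb; rewrite mul1r !le_max lexx orbT.
  apply: rate_le_mono (hth _ _ IH); last by rewrite le_max lexx.
  (* If [a0] is the larger term, it stays so because [th] is less than 1. *)
  rewrite exprS -mulrA; case: (leP a0 (th ^+ n * b')) => // _.
  by rewrite ge_max !le_max lexx ler_piMl ?(ltW th1) ?(ltW a0_gt0).
have th_lt1 : `|th| < 1 by rewrite ger0_norm.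
(* The added 1 keeps the denominator positive when [b'] is 0. *)
have e0 : 0 < a0 / (b' + 1) by rewrite divr_gt0// ltr_wpDl.
have /cvgr0Pnorm_le/(_ _ e0)[n _ /(_ n (leqnn n))] := cvg_expr th_lt1.
rewrite /= ger0_norm ?exprn_ge0// => hn.
apply: rate_le_mono (it n); rewrite ge_max lexx /=.
apply: le_trans (ler_wpM2r b'0 hn) _.
rewrite mulrAC ler_pdivrMr ?ltr_wpDl// ler_wpM2l ?(ltW a0_gt0)//.
by rewrite lerDl.
Qed.

(** * From balls of the group to short normal forms *)

Lemma short_ball (n : nat) (g : tree_aut) :
  ball_word ([set aut_t k] `|` range (@aut_x k)) n g ->
  short k' (n * weight_max k') g.
Proof.
have tt : aut_mul (aut_t k) (aut_t k) = aut_one.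
  apply: tree_aut_eqP => w; change (aut_t k (aut_t k w) = w).
  by rewrite !aut_t_flip -[LHS]/((flip _ \o flip _) w) flip_comp flip0.
have xx i : aut_mul (@aut_x k i) (aut_x i) = aut_one.
  apply: tree_aut_eqP => w; change (aut_x i (aut_x i w) = w).
  rewrite !aut_x_act -[LHS]/((act _ \o act _) w) act_xor.
  rewrite -[RHS]/(id w) -(act0 k').
  by congr (act _ w); apply/ffunP => j; rewrite !ffunE addbb.
(* The generators are involutions, so the inverses allowed in [ball_word] add no new letters. *)
have invol (x : tree_aut) : ([set aut_t k] `|` range (@aut_x k)) x ->
    (x^-1)%g = x.
  have H (y : tree_aut) : aut_mul y y = aut_one -> (y^-1)%g = y.
    by move=> yy; apply: (@mulgI _ y); rewrite mulgV; exact: esym yy.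
  by move=> [->|[i _ <-]]; apply: H; [exact: tt | exact: xx].
move=> [s [sz sS ->]]; apply: (@short_mono _ (size s * weight_max k')).
  by rewrite leq_mul2r sz orbT.
elim: s sS {sz} => [|x s IH] sS; first by rewrite big_nil; exact: short_id.
rewrite big_cons mulSn addnC.
set h := (\prod_(y <- s) y)%g in IH *.
have {}IH : short k' (size s * weight_max k') h.
  by apply: IH => y ys; apply: sS; rewrite inE ys orbT.
have Sx : ([set aut_t k] `|` range (@aut_x k)) x.
  have [//|Sx] := sS x (mem_head _ _).
  by have := invol _ Sx; rewrite invgK => ->.
rewrite -[X in short _ _ X]/(x \o h); case: Sx => [->|[i _ <-]].
  have -> : (aut_t k : word -> word) = flip true.
    by apply/funext => w; exact: aut_t_flip.
  apply: short_mono (short_flip true IH); rewrite leq_add2l /weight_max muln1.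
  by apply: leq_trans (leq_addr _ _); exact: leq_pmulr.
have -> : (aut_x i : word -> word) = act [ffun j => j == i].
  by apply/funext => w; exact: aut_x_act.
by apply: short_mono (short_act _ IH); rewrite leq_add2l weight_le_max.
Qed.

Lemma ball_card_bounds (n : nat) (c : R) :
  let S := [set aut_t k] `|` range (@aut_x k) in
  covered (short k' (n * weight_max k')) c ->
  1 <= ((ball_card S n)%:R : R) <= c.
Proof.
move=> S [l sl lP]; have fS : finite_set S.
  rewrite finite_setU; split; first exact: finite_set1.
  exact/finite_image/finite_finset.
have fB := ball_word_finite n fS.
apply/andP; split.
  rewrite ler1n /ball_card cardfs_gt0; apply/fset0Pn; exists 1%g.
  by rewrite in_fset_set// inE; exists [::]; rewrite big_nil.
apply: le_trans sl; rewrite ler_nat /ball_card.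
rewrite -(size_map aut_fun) uniq_leq_size//.
  by rewrite map_inj_uniq ?fset_uniq//; exact: val_inj.
move=> _ /mapP[g + ->]; rewrite in_fset_set// inE => /short_ball; exact: lP.
Qed.

Lemma kneading_group_subexponential :
  subexponential_growth R (kneading_group k).
Proof.
exists ([set aut_t k] `|` range (@aut_x k)); split=> //.
  rewrite finite_setU; split; first exact: finite_set1.
  exact/finite_image/finite_finset.
set b := ball_card _.
apply/cvgrPdist_le => e e0; pose W := weight_max k'.
(* Radius [n] means cost at most n W, contributing d W to the logarithm of the nth root; the
   remaining [d] absorbs C / n. *)
pose d := ln (1 + e) / (W%:R + 1).
have l0 : 0 < ln (1 + e) by rewrite ln_gt0// ltrDl.
have W1 : 0 < W%:R + 1 :> R by rewrite ltr_wpDl.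
have d0 : 0 < d by rewrite divr_gt0.
have [C hC] := rate_le_pos d0.
exists (Num.Def.archi_bound (C / d)).+1 => // n /= Nn.
have n0 : 0 < n%:R :> R by rewrite ltr0n; apply: leq_trans Nn.
have /andP[b1 bC] := ball_card_bounds (hC (n * W)%N).
have low : 1 <= (b n)%:R `^ n%:R^-1 :> R.
  by rewrite -[leLHS](powRr0 (b n)%:R) ler_powR// invr_ge0 ltW.
rewrite ler0_norm ?subr_le0// opprB lerBlDl.
have C_le : C / n%:R <= d.
  rewrite ler_pdivrMr// -ler_pdivrMl// mulrC.
  have [C0|C0] := leP 0 C; last first.
    by rewrite ltW// (lt_trans _ n0)// pmulr_llt0 ?invr_gt0.
  apply: ltW; apply: lt_trans (archi_boundP _) _; last by rewrite ltr_nat.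
  by rewrite divr_ge0 ?(ltW d0).
(* C <= exp(C) moves the constant into the exponent. *)
have up : (b n)%:R <= expR (C + d * (n * W)%:R) :> R.
  apply: le_trans bC _; rewrite expRD ler_wpM2r ?expR_ge0//.
  by apply: le_trans (expR_ge1Dx _); rewrite lerDr.
apply: le_trans (ge0_ler_powR _ _ _ up) _.
- by rewrite invr_ge0 ltW.
- by rewrite nnegrE.
- by rewrite nnegrE expR_ge0.
rewrite -expRM.
have -> : 1 + e = expR (d * (W%:R + 1)).
  by rewrite /d divfK ?gt_eqF// lnK// posrE addr_gt0.
rewrite ler_expR mulrDl mulrDr mulr1 [leRHS]addrC; apply: lerD => //.
by rewrite natrM [n%:R * _]mulrC mulrA mulfK// gt_eqF.
Qed.

End Rates.

Theorem theorem4p5 (R : realType) (k : nat) (hk : (2 <= k)%N) :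
  subexponential_growth R (kneading_group k).
Proof. by case: k hk => [//|k' _]; exact: kneading_group_subexponential. Qed.
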